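(* Let $p\ge 2$. (1) The number $h_{p,1}$ is a sharp upper bound for the number of segments of a lasso solution that intersect the interiors of orthants of the maximal dimension $p$ in $\mathbb R^p$, in nonnormalized cases. (2) The number $h_{p,2}$ is an upper bound for the number of segments of a lasso solution that intersect the interiors of orthants of the maximal dimension $p$ in $\mathbb R^p$, in normalized cases.
   Context: A data set consists of $N$ points $(x_1^{(i)},\dots,x_p^{(i)},y^{(i)})\in\mathbb R^{p+1}$ with centroid at the origin and not contained in any proper affine subspace (full rank assumption). Put $K=\frac1N\sum_i x^{(i)}(x^{(i)})^T$ (the $p\times p$ covariance matrix of the predictors, which is positive definite), $b=\frac1N\sum_i y^{(i)}x^{(i)}\in\mathbb R^p$, $\hat\beta=K^{-1}b$, $\hat t=\sum_j|\hat\beta_j|$. The data are normalized (normalized case) if $K_{jj}=1$ for all $j=1,\dots,p$; the nonnormalized case is that of data for which this normalization does not hold. For $t\ge0$ the lasso estimate $\beta(t)$ is the unique minimizer of $f(\beta)=\frac12\sum_i\big(y^{(i)}-\sum_j\beta_jx_j^{(i)}\big)^2$ over $\beta\in\mathbb R^p$ with $\sum_j|\beta_j|\le t$. The lasso solution (path) is the curve $t\mapsto\beta(t)$, $0\le t\le\hat t$, a polygonal chain from $\hat\beta$ to the origin. Its segments (of positive length) are the maximal portions along which the sign vector $(\operatorname{sgn}\beta_1,\dots,\operatorname{sgn}\beta_p)\in\{-1,0,1\}^p$ is constant; a segment intersects the interior of a $p$-dimensional orthant exactly when its sign vector has no zero entry. For integers $1\le r\le p$, $h_{p,r}$ denotes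 the maximal number of binary words of length $p$ such that every two of them match in at least $r$ spots. An upper bound is called sharp if it is attained, i.e. for every $p$ there is a data set of the type considered for which the number of such segments equals the bound. *)

(* Defs.v *)
From HB Require Import structures.
From mathcomp Require Import all_boot all_order all_algebra.
From mathcomp Require Import all_classical all_reals all_analysis.

Set Implicit Arguments.
Unset Strict Implicit.
Unset Printing Implicit Defensive.

Import Order.TTheory GRing.Theory Num.Theory.
Import numFieldNormedType.Exports.
Local Open Scope classical_set_scope.
Local Open Scope ring_scope.

(* The points are indexed (repetitions are allowed); datum i is the column
   vector (x_1, ..., x_p, y)^T. The full rank condition says that no translate
   v + U of a proper linear subspace U contains all of them. *)
Record dataset (R : realType) (p : nat) := Dataset {
  npoints : nat;
  datum : 'I_npoints -> 'cV[R]_(p + 1);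
  centered : npoints%:R^-1 *: \sum_(i < npoints) datum i = 0;
  full_rank : forall (v : 'cV[R]_(p + 1)) (U : {vspace 'cV[R]_(p + 1)}),
    (forall i, datum i - v \in U) -> U = fullv
}.

Section Lasso.
Variables (R : realType) (p : nat).
Implicit Types (D : dataset R p) (beta : 'cV[R]_p) (t : R).

Definition predictors D (i : 'I_(npoints D)) : 'cV[R]_p := usubmx (datum i).

Definition response D (i : 'I_(npoints D)) : R := dsubmx (datum i) 0 0.

Definition predictor_covariance D : 'M[R]_p :=
  (npoints D)%:R^-1 *: \sum_(i < npoints D) predictors i *m (predictors i)^T.

Definition cross_covariance D : 'cV[R]_p :=
  (npoints D)%:R^-1 *: \sum_(i < npoints D) response i *: predictors i.

Definition normalized D : Prop := forall j, predictor_covariance D j j = 1.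

Definition beta_hat D : 'cV[R]_p := invmx (predictor_covariance D) *m cross_covariance D.

Definition l1norm beta : R := \sum_j `|beta j 0|.

Definition t_hat D : R := l1norm (beta_hat D).

Definition rss D beta : R :=
  2^-1 * \sum_(i < npoints D)
    (response i - \sum_j beta j 0 * predictors i j 0) ^+ 2.

Definition lasso_minimizers D t : set 'cV[R]_p :=
  [set beta | l1norm beta <= t /\
    forall beta', l1norm beta' <= t -> rss D beta <= rss D beta'].

(* For t >= 0 the set of minimizers is a singleton, and lasso D t is its
   element; the default value 0 is only taken for t < 0. *)
Definition lasso D t : 'cV[R]_p := xget 0 (lasso_minimizers D t).

Definition sign_vector beta : 'cV[R]_p := map_mx Num.sg beta.

(* Portions of the path are described by intervals of parameters. *)
Definition constant_sign_portion D (I : set R) : Prop :=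
  [/\ I `<=` [set t | 0 <= t <= t_hat D],
      is_interval I &
      forall s t, I s -> I t ->
        sign_vector (lasso D s) = sign_vector (lasso D t)].

Definition maximal_portion D (I : set R) : Prop :=
  constant_sign_portion D I /\
  forall J, constant_sign_portion D J -> I `<=` J -> J = I.

Definition segments D : set (set 'cV[R]_p) :=
  [set S | exists I : set R, [/\ maximal_portion D I,
     S = lasso D @` I &
     exists u v, [/\ S u, S v & u != v]]].

Definition orthant (e : 'I_p -> bool) : set 'cV[R]_p :=
  [set x | forall j, 0 <= (-1) ^+ e j * x j 0].

Definition full_dim_segments D : set (set 'cV[R]_p) :=
  [set S | segments D S /\ exists e, S `&` (orthant e)° !=set0].

End Lasso.

Definition matches (p : nat) (u v : p.-tuple bool) : nat :=
  #|[pred j | tnth u j == tnth v j]|.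

Definition max_matching_words (p r : nat) : nat :=
  \max_(A : {set p.-tuple bool} |
        [forall u in A, forall v in A, (u != v) ==> (r <= matches u v)%N]) #|A|.

(* Main.v *)
(** Write [K], [b] for the covariances.  A path point [beta] with nonzero signs
[s] satisfies the stationarity equation [K beta = b - lam s] with [lam >= 0];
convexity then shows that a sign pattern without zeros is used by at most one
segment.  If [s] and [-s] both occur, at [beta] and [gam] say, then
[(beta - gam)^T K (beta - gam) <= 0], which is impossible; if [K] has unit
diagonal, Cauchy-Schwarz also excludes sign patterns matching in one spot only.
Conversely, Mairal and Yu's recursive construction provides data for which one
of [s], [-s] occurs for every [s], hence as many full-dimensional segments as
there are words in any family without complementary pairs. *)
Require Import Defs.
From HB Require Import structures.
From mathcomp Require Import all_boot all_order all_algebra.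
From mathcomp Require Import all_classical all_reals all_analysis.
From mathcomp Require Import ring lra.

Set Implicit Arguments.
Unset Strict Implicit.
Unset Printing Implicit Defensive.

Import Order.TTheory GRing.Theory Num.Theory.
Import numFieldNormedType.Exports.
Local Open Scope classical_set_scope.
Local Open Scope ring_scope.
Local Open Scope card_scope.

(** * The Euclidean pairing of column vectors *)

Section DotProduct.
Variables (R : realType).

Definition dot n (u v : 'cV[R]_n) : R := \sum_j u j 0 * v j 0.

Lemma dotE n (u v : 'cV[R]_n) : dot u v = (u^T *m v) 0 0.
Proof. by rewrite mxE; apply: eq_bigr => j _; rewrite mxE. Qed.

Lemma dotC n (u v : 'cV[R]_n) : dot u v = dot v u.
Proof. by apply: eq_bigr => j _; rewrite mulrC. Qed.

Lemma dotDr n (u v w : 'cV[R]_n) : dot u (v + w) = dot u v + dot u w.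
Proof. by rewrite !dotE mulmxDr mxE. Qed.

Lemma dotZr n (c : R) (u v : 'cV[R]_n) : dot u (c *: v) = c * dot u v.
Proof. by rewrite !dotE -scalemxAr mxE. Qed.

Lemma dotNr n (u v : 'cV[R]_n) : dot u (- v) = - dot u v.
Proof. by rewrite -scaleN1r dotZr mulN1r. Qed.

Lemma dotBr n (u v w : 'cV[R]_n) : dot u (v - w) = dot u v - dot u w.
Proof. by rewrite dotDr dotNr. Qed.

Lemma dotZl n (c : R) (u v : 'cV[R]_n) : dot (c *: u) v = c * dot u v.
Proof. by rewrite dotC dotZr dotC. Qed.

Lemma dotBl n (u v w : 'cV[R]_n) : dot (u - v) w = dot u w - dot v w.
Proof. by rewrite dotC dotBr !(dotC w). Qed.

Lemma dot_delta n j (v : 'cV[R]_n) : dot (delta_mx j 0) v = v j 0.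
Proof.
rewrite /dot (bigD1 j) //= !mxE !eqxx mul1r big1 ?addr0 // => i ij.
by rewrite mxE (negPf ij) mul0r.
Qed.

Lemma dot_mulmx m n (A : 'M[R]_(m, n)) u v : dot u (A *m v) = dot (A^T *m u) v.
Proof. by rewrite !dotE trmx_mul trmxK mulmxA. Qed.

Lemma dot_delta_mulmx n (A : 'M[R]_n) i j :
  dot (delta_mx i 0) (A *m delta_mx j 0) = A i j.
Proof. by rewrite dot_delta -colE mxE. Qed.

End DotProduct.

(** * Sign vectors without zero entries *)

Definition signs (R : realType) p (e : 'I_p -> bool) : 'cV[R]_p :=
  \col_j (-1) ^+ e j.

Section Signs.
Variables (R : realType) (p : nat).
Implicit Types (e : 'I_p -> bool) (beta : 'cV[R]_p).

Lemma sign_vectorP beta e :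
  sign_vector beta = signs R e <-> forall j, 0 < (-1) ^+ e j * beta j 0.
Proof.
split=> [se j|he].
  have := congr1 (fun m : 'cV[R]_p => m j 0) se; rewrite !mxE => sj.
  by rewrite -sj -normrEsg normr_gt0 -sgr_eq0 sj signr_eq0.
apply/matrixP => j k; rewrite !mxE ord1.
have := he j; case: (e j); rewrite ?expr1 ?expr0 ?mulN1r ?mul1r ?oppr_gt0.
  by move/ltr0_sg.
by move/gtr0_sg.
Qed.

Lemma sign_vector_inj beta e1 e2 :
  sign_vector beta = signs R e1 -> sign_vector beta = signs R e2 -> e1 =1 e2.
Proof.
move=> -> h j; have := congr1 (fun m : 'cV[R]_p => m j 0) h; rewrite !mxE.
exact: signr_inj.
Qed.

Lemma dot_signs_le beta e : dot (signs R e) beta <= l1norm beta.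
Proof.
apply: ler_sum => j _; rewrite mxE.
by apply: le_trans (ler_norm _) _; rewrite normrMsign.
Qed.

Lemma dot_signs beta e :
  sign_vector beta = signs R e -> dot (signs R e) beta = l1norm beta.
Proof.
move/sign_vectorP => he; apply: eq_bigr => j _; rewrite mxE.
by rewrite -[LHS]ger0_norm ?ltW // normrMsign.
Qed.

End Signs.

(** * Positive definiteness of the covariance and the quadratic expansion of the loss *)

Section Covariance.
Variables (R : realType) (p : nat) (D : dataset R p).
Local Notation K := (predictor_covariance D).
Local Notation b := (cross_covariance D).
Local Notation N := ((npoints D)%:R : R).

Lemma npoints_gt0 : 0 < N.
Proof.
rewrite ltr0n lt0n; apply/eqP => N0.
have h : (0 : {vspace 'cV[R]_(p + 1)})%VS = fullv.
  apply: (@full_rank _ _ D 0) => i; by have := leq_trans (ltn_ord i) (eq_leq N0).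
have := memvf (const_mx 1 : 'cV[R]_(p + 1)); rewrite -h memv0 => /eqP.
move/matrixP/(_ (rshift p 0) 0); rewrite !mxE => /eqP; exact/negP/oner_neq0.
Qed.

Lemma dot_cov u v :
  dot u (K *m v) = N^-1 * \sum_(i < npoints D) dot (predictors i) u * dot (predictors i) v.
Proof.
rewrite -scalemxAl dotZr; congr (_ * _).
rewrite mulmx_suml dotE mulmx_sumr summxE; apply: eq_bigr => i _.
rewrite -(mulmxA (predictors i)) mulmxA [LHS]mxE big_ord1.
by rewrite -!dotE (dotC u).
Qed.

Lemma dot_cross v :
  dot b v = N^-1 * \sum_(i < npoints D) response i * dot (predictors i) v.
Proof.
rewrite dotZl; congr (_ * _).
rewrite dotC dotE mulmx_sumr summxE; apply: eq_bigr => i _.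
by rewrite -scalemxAr mxE -dotE dotC.
Qed.

Lemma cov_sym : K^T = K.
Proof.
rewrite linearZ /=; congr (_ *: _); rewrite linear_sum; apply: eq_bigr => i _ /=.
by rewrite trmx_mul trmxK.
Qed.

Lemma dot_covC u v : dot u (K *m v) = dot v (K *m u).
Proof. by rewrite dot_mulmx cov_sym dotC. Qed.

Lemma dot_cov_subZ c u v :
  dot (v - c *: u) (K *m (v - c *: u))
  = dot v (K *m v) - 2 * c * dot u (K *m v) + c ^+ 2 * dot u (K *m u).
Proof.
rewrite mulmxBr -scalemxAr !dotBl !dotBr !dotZl !dotZr (dot_covC v u); ring.
Qed.

(** The linear form with coefficient vector [(v, 0)] vanishes on all data points, so by full rank
    its kernel is the whole space. Evaluated at [(v, 0)] itself, the form gives the sum of squares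
    of [v]. *)
Lemma predictors_span v : (forall i : 'I_(npoints D), dot (predictors i) v = 0) -> v = 0.
Proof.
move=> hv; pose A : 'rV[R]_(p + 1) := (col_mx v 0)^T.
have h : lker (linfun (mulmx A : 'cV_(p + 1) -> 'cV_1)) = fullv.
  apply: (@full_rank _ _ D 0) => i; rewrite subr0 memv_ker lfunE /=.
  apply/eqP/matrixP => k l; rewrite !ord1 -dotE mxE -[datum i]vsubmxK.
  rewrite dotE tr_col_mx mul_row_col trmx0 mul0mx addr0 -dotE dotC.
  exact: hv.
have : col_mx v 0 \in lker (linfun (mulmx A : 'cV_(p + 1) -> 'cV_1)).
  by rewrite h memvf.
rewrite memv_ker lfunE /= => /eqP/matrixP/(_ 0 0).
rewrite /A tr_col_mx mul_row_col mulmx0 addr0 -dotE mxE => /eqP.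
rewrite psumr_eq0 => [/allP v0|j _]; last exact: sqr_ge0.
apply/matrixP => j k; rewrite ord1 mxE.
by have := v0 j (mem_index_enum _); rewrite mulf_eq0 orbb => /eqP.
Qed.

Lemma cov_pos v : v != 0 -> 0 < dot v (K *m v).
Proof.
move=> v0; rewrite dot_cov mulr_gt0 ?invr_gt0 ?npoints_gt0 //.
rewrite lt_def sumr_ge0 ?andbT => [|i _]; last exact: sqr_ge0.
apply: contra v0 => /eqP/psumr_eq0P h; apply/eqP/predictors_span => i.
by apply/eqP; rewrite -sqrf_eq0 expr2 h // => j _; exact: sqr_ge0.
Qed.

Lemma cov_ge0 v : 0 <= dot v (K *m v).
Proof.
have [->|/cov_pos/ltW//] := eqVneq v 0.
by rewrite mulmx0 dotE mulmx0 mxE.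
Qed.

Lemma cov_inj (v : 'cV[R]_p) : K *m v = 0 -> v = 0.
Proof.
move=> Kv; apply/eqP; apply: contraT => /cov_pos.
by rewrite Kv dotE mulmx0 mxE ltxx.
Qed.

Lemma cov_unit : K \in unitmx.
Proof.
rewrite -unitmx_tr -row_free_unit; apply: inj_row_free => v hv.
apply: trmx_inj; rewrite trmx0; apply: cov_inj.
by rewrite -[LHS]trmxK trmx_mul trmxK hv trmx0.
Qed.

Lemma beta_hatP beta : K *m beta = b <-> beta = beta_hat D.
Proof.
split=> [h|->]; first by rewrite /beta_hat -h mulmxA mulVmx ?mul1mx // cov_unit.
by rewrite /beta_hat mulmxA mulmxV ?mul1mx // cov_unit.
Qed.

(** The loss is quadratic, so this Taylor expansion is exact; the factor [N] undoes the averaging in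
    [K] and [b]. *)
Lemma rss_expand beta h :
  rss D (beta + h) = rss D beta
    + N * (dot (K *m beta - b) h + 2^-1 * dot h (K *m h)).
Proof.
rewrite dotBl (dotC (K *m _)) !dot_cov dot_cross.
have N0 := npoints_gt0.
set S1 := \sum_i _ * _; set S2 := \sum_i _ * _; set S3 := \sum_i _ * _.
have -> : N * (N^-1 * S1 - N^-1 * S2 + 2^-1 * (N^-1 * S3))
   = S1 - S2 + 2^-1 * S3 by field; rewrite gt_eqF.
rewrite /rss !mulr_sumr -sumrB -!big_split /=; apply: eq_bigr => i _.
have E (v : 'cV_p) : \sum_j v j 0 * predictors i j 0 = dot (predictors i) v.
  by rewrite dotC.
by rewrite !E dotDr; field.
Qed.

End Covariance.

(** The inverse of one plus the sum of all inverses serves as bound; the summand 1 covers an empty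
    [I]. *)
Lemma finite_lower_bound (R : realType) (I : finType) (F : I -> R) :
  (forall i, 0 < F i) -> exists2 eps, 0 < eps & forall i, eps <= F i.
Proof.
move=> F0; have S0 : 0 < 1 + \sum_i (F i)^-1.
  by rewrite ltr_wpDr ?ltr01 // sumr_ge0 // => i _; rewrite invr_ge0 ltW.
exists (1 + \sum_i (F i)^-1)^-1 => [|i]; first by rewrite invr_gt0.
rewrite -[leRHS]invrK lef_pV2 ?posrE ?invr_gt0 // (bigD1 i) //= addrCA lerDl.
by rewrite addr_ge0 // sumr_ge0 // => j _; rewrite invr_ge0 ltW.
Qed.

(** * The l1 norm under single-coordinate changes *)

Section L1Norm.
Variables (R : realType) (p : nat).
Implicit Types (u v : 'cV[R]_p).

Lemma l1norm_triangle u v : l1norm (u + v) <= l1norm u + l1norm v.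
Proof. by rewrite -big_split; apply: ler_sum => j _; rewrite mxE ler_normD. Qed.

Lemma l1normZ c u : l1norm (c *: u) = `|c| * l1norm u.
Proof. by rewrite mulr_sumr; apply: eq_bigr => j _; rewrite mxE normrM. Qed.

Lemma l1norm_delta j : l1norm (delta_mx j 0 : 'cV[R]_p) = 1.
Proof.
rewrite /l1norm (bigD1 j) //= mxE !eqxx normr1 big1 ?addr0 // => i ij.
by rewrite mxE (negPf ij) normr0.
Qed.

Lemma l1norm_erase u j :
  l1norm (u - u j 0 *: delta_mx j 0) = l1norm u - `|u j 0|.
Proof.
rewrite /l1norm (bigD1 j) //= [in RHS](bigD1 j) //=.
rewrite !mxE !eqxx mulr1 subrr normr0 add0r addrAC subrr add0r.
by apply: eq_bigr => i ij; rewrite !mxE (negPf ij) mulr0 subr0.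
Qed.

Lemma l1norm_ge0 u : 0 <= l1norm u.
Proof. exact: sumr_ge0. Qed.

End L1Norm.

(** * Optimality conditions inside an orthant *)

Section KKT.
Variables (R : realType) (p : nat) (D : dataset R p).
Local Notation K := (predictor_covariance D).
Local Notation b := (cross_covariance D).

Lemma minimizer_first_order t beta beta' :
  lasso_minimizers D t beta -> l1norm beta' <= t ->
  0 <= dot (K *m beta - b) (beta' - beta).
Proof.
move=> [bt bmin] b't; set c := dot _ _.
set q := dot (beta' - beta) (K *m (beta' - beta)).
have q0 : 0 <= q by exact: cov_ge0.
have [//|c0] := leP 0 c.
(* This step lies in [(0, 1]] even if [q = 0], and it turns the increment [c + eps * q / 2] into
   [c * (1 + eps) / 2], which is negative. *)
pose eps := - c / (q - c).
have qc : 0 < q - c by lra.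
have e0 : 0 < eps by apply: divr_gt0 => //; rewrite oppr_gt0.
have e1 : eps <= 1 by rewrite /eps ler_pdivrMr // mul1r lerDr.
have : l1norm (beta + eps *: (beta' - beta)) <= t.
  have -> : beta + eps *: (beta' - beta) = (1 - eps) *: beta + eps *: beta'.
    by apply/matrixP => i j; rewrite !mxE; ring.
  apply: le_trans (l1norm_triangle _ _) _; rewrite !l1normZ.
  rewrite ger0_norm ?subr_ge0 // (ger0_norm (ltW e0)).
  have le1 : 0 <= 1 - eps by rewrite subr_ge0.
  apply: le_trans (lerD (ler_wpM2l le1 bt) (ler_wpM2l (ltW e0) b't)) _.
  by rewrite -mulrDl subrK mul1r.
move=> /bmin; rewrite rss_expand -scalemxAr !dotZl !dotZr -/c -/q lerDl.
rewrite pmulr_rge0 ?npoints_gt0 // => h.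
have E : eps * (q - c) = - c by rewrite /eps divfK // gt_eqF.
have : 0 <= c + 2^-1 * (eps * q) by rewrite -(pmulr_rge0 _ e0); lra.
have : eps * q = c * eps - c by lra.
have : c * eps < 0 by rewrite nmulr_rlt0.
lra.
Qed.

(* The Karush-Kuhn-Tucker conditions in the interior of the orthant [e]. *)
Definition stationary (e : 'I_p -> bool) (lam : R) (beta : 'cV[R]_p) :=
  [/\ 0 <= lam, sign_vector beta = signs R e & K *m beta = b - lam *: signs R e].

Lemma minimizer_stationary t beta e : (0 < p)%N ->
  lasso_minimizers D t beta -> sign_vector beta = signs R e ->
  exists lam, stationary e lam beta /\ lam * (t - l1norm beta) = 0.
Proof.
move=> p0 bmin se; have /sign_vectorP spos := se; have [bt _] := bmin.
set g := K *m beta - b; pose a j := (-1) ^+ e j * g j 0.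
have first := minimizer_first_order bmin.
have normb j : `|beta j 0| = (-1) ^+ e j * beta j 0.
  by rewrite -[RHS]ger0_norm ?ltW // normrMsign.
have bg j : beta j 0 * g j 0 = `|beta j 0| * a j.
  by rewrite /a normb mulrACA -expr2 sqrr_sign mul1r.
have npos j : 0 < `|beta j 0| by rewrite normb.
have a_le0 j : a j <= 0.
  have /first : l1norm (beta - beta j 0 *: delta_mx j 0) <= t.
    by rewrite l1norm_erase; have := npos j; lra.
  rewrite (addrC beta) addrK dotNr dotZr dotC dot_delta oppr_ge0 -/g bg.
  by rewrite pmulr_rle0.
have a_le i j : a i <= a j.
  pose v := (`|beta i 0| * (-1) ^+ e j) *: (delta_mx j 0 : 'cV[R]_p).
  have /first : l1norm (beta - beta i 0 *: delta_mx i 0 + v) <= t.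
    apply: le_trans (l1norm_triangle _ _) _.
    rewrite l1norm_erase l1normZ l1norm_delta mulr1 normrM normrX normrN1.
    by rewrite expr1n mulr1 normr_id; lra.
  rewrite -(addrA beta) (addrC beta) addrK dotDr dotNr !dotZr !(dotC _ (delta_mx _ _)) !dot_delta -/g.
  by rewrite bg -mulrA -/(a j) addrC subr_ge0 ler_pM2l.
pose j0 := Ordinal p0.
have aE j : a j = a j0 by apply/le_anti; rewrite !a_le.
exists (- a j0); split; first split => //; first by rewrite oppr_ge0.
  rewrite scaleNr opprK -[LHS](subrK b) -/g addrC; congr (_ + _).
  apply/matrixP => j k; rewrite ord1 [RHS]mxE [X in _ * X]mxE -(aE j).
  by rewrite mulrC signrMK.
apply/eqP; rewrite mulNr oppr_eq0 eq_le; apply/andP; split.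
  by rewrite mulr_le0_ge0 // subr_ge0.
pose v := ((t - l1norm beta) * (-1) ^+ e j0) *: (delta_mx j0 0 : 'cV[R]_p).
have /first : l1norm (beta + v) <= t.
  apply: le_trans (l1norm_triangle _ _) _.
  rewrite l1normZ l1norm_delta mulr1 normrM normrX normrN1 expr1n mulr1.
  by rewrite ger0_norm ?subr_ge0 //; lra.
by rewrite (addrC beta) addrK dotZr dotC dot_delta -/g -mulrA -/(a j0) mulrC.
Qed.

(** Stationarity makes the linear term of the expansion nonnegative on the l1 ball, so the loss
    exceeds its value at [beta] by at least the quadratic term. Positive definiteness then gives
    uniqueness, which identifies the element chosen by [xget]. *)
Lemma stationary_lasso e lam beta :
  stationary e lam beta -> lasso D (l1norm beta) = beta.
Proof.
move=> [lam0 se Kb].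
have gE : K *m beta - b = - lam *: signs R e by rewrite Kb addrC addKr scaleNr.
have lower beta' : l1norm beta' <= l1norm beta ->
    rss D beta + (npoints D)%:R * (2^-1 * dot (beta' - beta) (K *m (beta' - beta)))
      <= rss D beta'.
  move=> h; rewrite -{3}[beta'](subrK beta) (addrC _ beta) rss_expand lerD2l.
  rewrite ler_pM2l ?npoints_gt0 // lerDr gE dotZl dotBr (dot_signs se).
  rewrite mulNr -mulrN opprB mulr_ge0 // subr_ge0.
  exact: le_trans (dot_signs_le _ _) h.
have bmin : lasso_minimizers D (l1norm beta) beta.
  split=> // beta' /lower; apply: le_trans; rewrite lerDl mulr_ge0 //.
  by rewrite mulr_ge0 ?invr_ge0 ?cov_ge0.
rewrite /lasso; case: xgetP => [beta' _ [h min']|/(_ beta)//].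
apply/eqP; rewrite -subr_eq0; apply: contraT => /(@cov_pos _ _ D) q.
have := le_trans (lower _ h) (min' beta (lexx _)).
rewrite gerDl leNgt => /negP; case; rewrite mulr_gt0 ?npoints_gt0 //.
by rewrite mulr_gt0 // invr_gt0.
Qed.

(** Otherwise [K (beta_hat - beta) = lam s], paired with [beta_hat - beta], would be nonpositive. *)
Lemma stationary_l1norm e lam beta :
  stationary e lam beta -> l1norm beta <= t_hat D.
Proof.
move=> [lam0 se Kb]; rewrite leNgt; apply/negP => lt.
have /beta_hatP Kbh : beta_hat D = beta_hat D by [].
have [h|/(@cov_pos _ _ D)] := eqVneq (beta_hat D - beta) 0.
  by move: lt; rewrite /t_hat (subr0_eq h) ltxx.
rewrite mulmxBr Kbh Kb subKr dotZr dotBl !(dotC _ (signs _ _)).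
rewrite (dot_signs se) ltNge => /negP; apply; rewrite mulr_ge0_le0 //.
rewrite subr_le0; apply: le_trans (dot_signs_le _ _) (ltW lt).
Qed.

(** For opposite signs [K (beta - beta') = - (lam + lam') s], and pairing with [beta - beta'] yields
    [- (lam + lam')] times the sum of both l1 norms. If [beta = beta'], the signs agree outright. *)
Lemma stationary_opposite e e' lam lam' beta beta' : (0 < p)%N ->
  stationary e lam beta -> stationary e' lam' beta' ->
  exists j, e j = e' j.
Proof.
move=> p0 st st'; apply: contrapT => /forallNP ne.
have sE : signs R e' = - signs R e.
  apply/matrixP => j k; rewrite !mxE; have := ne j.
  by case: (e j); case: (e' j) => // _; rewrite ?expr1 ?expr0 ?opprK.
case: st st' => lam0 se Kb [lam0' se' Kb'].
have Kd : K *m (beta - beta') = - (lam + lam') *: signs R e.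
  by rewrite mulmxBr Kb Kb' sE; apply/matrixP => i j; rewrite !mxE; ring.
have d0 : dot (signs R e) beta' = - l1norm beta'.
  by rewrite -(dot_signs se') sE -(scaleN1r (signs R e)) dotZl mulN1r opprK.
have [h|/(@cov_pos _ _ D)] := eqVneq (beta - beta') 0; last first.
  rewrite Kd dotZr dotC dotBr d0 (dot_signs se) opprK ltNge => /negP; apply.
  by rewrite mulNr oppr_le0 mulr_ge0 ?addr_ge0 ?l1norm_ge0.
apply: (ne (Ordinal p0)); apply: (@sign_vector_inj R _ beta) => //.
by rewrite (subr0_eq h).
Qed.

End KKT.

(** * Unit diagonal: a single match is impossible *)

Section NormalizedCovariance.
Variables (R : realType) (p : nat) (D : dataset R p).
Hypothesis nD : normalized D.
Local Notation K := (predictor_covariance D).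

Lemma cov_entry_le1 i j : `|K i j| <= 1.
Proof.
have sgn_ge (c : R) : c ^+ 2 = 1 -> 0 <= 1 - c * K i j.
  move=> c1; have := cov_ge0 D (delta_mx i 0 - c *: delta_mx j 0).
  rewrite dot_cov_subZ dot_covC !dot_delta_mulmx !nD c1; lra.
have := sgn_ge 1; have := sgn_ge (-1); rewrite sqrrN expr1n mul1r mulN1r.
by move=> /(_ erefl) h1 /(_ erefl) h2; rewrite ler_norml; lra.
Qed.

(* With [d = beta - beta'], [u = (-1) ^+ e j0 *: delta_mx j0 0] and [w] the
   vector [d] with its [j0]-th entry erased, [m = <u, K w>] satisfies
   [m ^+ 2 < <w, K w>] (Cauchy-Schwarz, as [<u, K u> = 1]) and
   [`|m| <= l1norm w]; the stationarity equations paired with [u] and [w] then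
   contradict each other. *)
Lemma stationary_single_match_le e e' lam lam' beta beta' j0 j1 :
  lam <= lam' -> stationary D e lam beta -> stationary D e' lam' beta' ->
  e j0 = e' j0 -> j1 != j0 -> ~ (forall j, j != j0 -> e j != e' j).
Proof.
move=> lele [lam0 /sign_vectorP se Kb] [lam0' /sign_vectorP se' Kb'] e0 j10 ne.
pose d := beta - beta'; pose s0 : R := (-1) ^+ e j0.
have ss : s0 * s0 = 1 by rewrite -expr2 sqrr_sign.
pose E : 'cV[R]_p := delta_mx j0 0; pose w := d - d j0 0 *: E.
have Kd : K *m d = lam' *: signs R e' - lam *: signs R e.
  by rewrite mulmxBr Kb Kb'; apply/matrixP => i j; rewrite !mxE; ring.
have wj0 : w j0 0 = 0 by rewrite !mxE !eqxx mulr1 subrr.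
have wj j : j != j0 -> w j 0 = d j 0.
  by move=> jj; rewrite !mxE (negPf jj) mulr0 subr0.
have e'j j : j != j0 -> (-1) ^+ e' j = - (-1) ^+ e j :> R.
  by move=> /ne; case: (e j); case: (e' j) => //; rewrite ?expr1 ?expr0 ?opprK.
have sw j : j != j0 -> 0 < (-1) ^+ e j * w j 0.
  move=> jj; rewrite wj // !mxE mulrBr subr_gt0; apply: lt_trans (se j).
  by rewrite -oppr_gt0 -mulNr -e'j.
have normw j : j != j0 -> `|w j 0| = (-1) ^+ e j * w j 0.
  move=> /sw h.
  by rewrite -[RHS]ger0_norm ?ltW // normrMsign.
pose m := s0 * dot E (K *m w); pose Q := dot w (K *m w); pose sg := l1norm w.
have dE : d = d j0 0 *: E + w by rewrite addrC subrK.
have eq1 : s0 * d j0 0 + m = lam' - lam.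
  have : dot E (K *m d) = s0 * (lam' - lam).
    by rewrite Kd dot_delta !mxE -e0 -/s0; ring.
  rewrite {1}dE mulmxDr -scalemxAr dotDr dotZr dot_delta_mulmx nD => h.
  by rewrite /m -mulrDr -[X in _ * (X + _)]mulr1 h mulrA ss mul1r.
have eq2 : s0 * d j0 0 * m + Q = - (lam' + lam) * sg.
  have : dot w (K *m d) = - (lam' + lam) * sg.
    rewrite /dot mulr_sumr; apply: eq_bigr => j _.
    have [->|jj] := eqVneq j j0; first by rewrite wj0 normr0 mul0r mulr0.
    have -> : (K *m d) j 0 = - (lam' + lam) * (-1) ^+ e j.
      by rewrite Kd !mxE e'j //; ring.
    by rewrite normw //; ring.
  rewrite {1}dE mulmxDr -scalemxAr dotDr dotZr dot_covC -/Q => <-.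
  by rewrite /m mulrACA ss mul1r.
have QE : m ^+ 2 < Q.
  have : w - (m * s0) *: E != 0.
    apply/eqP => /matrixP/(_ j1 0); rewrite [LHS]mxE [X in _ + X]mxE [X in - X]mxE.
    rewrite [X in _ * X]mxE (negPf j10) /= mulr0 subr0 [RHS]mxE => w0.
    by have := sw _ j10; rewrite w0 mulr0 ltxx.
  move/(@cov_pos _ _ D); rewrite dot_cov_subZ dot_delta_mulmx nD -/Q.
  have -> : (m * s0) ^+ 2 = m ^+ 2 by rewrite exprMn (expr2 s0) ss mulr1.
  have -> : 2 * (m * s0) * dot E (K *m w) = 2 * m ^+ 2 by rewrite /m; ring.
  by lra.
have mle : `|m| <= sg.
  rewrite normrMsign dot_delta mxE.
  apply: le_trans (ler_norm_sum _ _ _) _; apply: ler_sum => j _.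
  by rewrite normrM ler_piMl // cov_entry_le1.
have sg0 : 0 <= sg by exact: l1norm_ge0.
(* Eliminating [d j0 0] from [eq1] and [eq2] gives [Q - m ^+ 2 = - (lam' - lam) * (m + sg) - 2 * lam
   * sg], whose right side is nonpositive because [lam <= lam']. *)
have ams : 0 <= (lam' - lam) * (m + sg).
  by rewrite mulr_ge0 ?subr_ge0 //; move: mle; rewrite ler_norml; lra.
have lsg : 0 <= lam * sg by rewrite mulr_ge0.
move: eq2; have -> : s0 * d j0 0 = lam' - lam - m by lra.
nra.
Qed.

(** The two points play symmetric roles, so the multipliers may be ordered; [1 < p] supplies the
    coordinate that makes [w] nonzero. *)
Lemma stationary_two_matches e e' lam lam' beta beta' j0 : (1 < p)%N ->
  stationary D e lam beta -> stationary D e' lam' beta' ->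
  e j0 = e' j0 -> exists2 j, j != j0 & e j = e' j.
Proof.
move=> p1 st st' e0.
have [j1 j10] : exists j1, j1 != j0.
  have : (0 < #|predC1 j0|)%N by rewrite cardC1 card_ord; case: (p) p1 => [|[]].
  by move/card_gt0P => [j hj]; exists j.
apply: contrapT => /forall2NP ne.
have ne1 j : j != j0 -> e j != e' j by move=> jj; case: (ne j) => // /eqP.
have ne2 j : j != j0 -> e' j != e j by move=> /ne1; rewrite eq_sym.
have [le|/ltW le] := leP lam lam'.
  exact: (stationary_single_match_le le st st' e0 j10 ne1).
exact: (stationary_single_match_le le st' st (esym e0) j10 ne2).
Qed.

End NormalizedCovariance.

(** * Full-dimensional segments correspond to sign patterns *)

Section Portions.
Variables (R : realType) (p : nat) (D : dataset R p).
Hypothesis p0 : (0 < p)%N.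
Local Notation K := (predictor_covariance D).
Local Notation b := (cross_covariance D).
Implicit Types e : 'I_p -> bool.

Definition portion e : set R :=
  [set t | 0 <= t <= t_hat D /\ sign_vector (lasso D t) = signs R e].

(** The default 0 of [xget] has a zero sign, so a genuine minimizer was chosen. Slackness makes the
    constraint active unless [lam = 0]; then the point is [beta_hat], whose norm [t_hat D] is at
    least [t]. *)
Lemma portion_stationary e t : portion e t ->
  exists2 lam, stationary D e lam (lasso D t) & l1norm (lasso D t) = t.
Proof.
move=> [/andP[_ tt] se].
have lmin : lasso_minimizers D t (lasso D t).
  move: se; rewrite /lasso; case: xgetP => // _ /sign_vectorP/(_ (Ordinal p0)).
  by rewrite mxE mulr0 ltxx.
have [lam [st /eqP]] := minimizer_stationary p0 lmin se.
rewrite mulf_eq0 subr_eq0 => /orP[/eqP lam0|/eqP <-]; exists lam => //.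
apply: le_anti; rewrite lmin.1 (le_trans tt) //.
case: st => _ _; rewrite lam0 scale0r subr0 => /beta_hatP ->; exact: lexx.
Qed.

Lemma portion_of_stationary e lam beta : stationary D e lam beta -> portion e (l1norm beta).
Proof.
move=> st; split; first by rewrite l1norm_ge0 (stationary_l1norm st).
by rewrite (stationary_lasso st); case: st.
Qed.

Lemma stationary_convex e lam mu beta gam c : 0 <= c <= 1 ->
  stationary D e lam beta -> stationary D e mu gam ->
  stationary D e ((1 - c) * lam + c * mu) ((1 - c) *: beta + c *: gam).
Proof.
move=> /andP[c0 c1] [l0 /sign_vectorP sb Kb] [m0 /sign_vectorP sg Kg].
have c1' : 0 <= 1 - c by rewrite subr_ge0.
split; first by rewrite addr_ge0 // mulr_ge0.
  apply/sign_vectorP => j; rewrite !mxE mulrDr (mulrCA _ (1 - c)) (mulrCA _ c).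
  have [->|cn] := eqVneq c 0; first by rewrite mul0r addr0 subr0 mul1r.
  apply: ltr_wpDl; first by apply: mulr_ge0 => //; exact/ltW/sb.
  by apply: mulr_gt0 => //; rewrite lt_def cn.
rewrite mulmxDr -!scalemxAr Kb Kg; apply/matrixP => i j; rewrite !mxE; ring.
Qed.

(** Stationary points of one orthant form a convex set on which the l1 norm is linear, so
    interpolating between the end points reaches every intermediate parameter. *)
Lemma portion_interval e : is_interval (portion e).
Proof.
move=> x y ex ey z /andP[xz zy].
have [xy|yx] := ltP x y; last first.
  by rewrite (_ : z = x) //; apply/le_anti; rewrite xz (le_trans zy).
have [lam sx nx] := portion_stationary ex; have [mu sy ny] := portion_stationary ey.
pose c := (z - x) / (y - x).
have c01 : 0 <= c <= 1.
  rewrite divr_ge0 ?subr_ge0 ?(ltW xy) //= ler_pdivrMr ?subr_gt0 // mul1r.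
  by rewrite lerD2r.
have st := stationary_convex c01 sx sy; have [_ se _] := st.
have := portion_of_stationary st; rewrite -(dot_signs se) dotDr !dotZr.
rewrite !dot_signs ?nx ?ny; [|by case: sy|by case: sx].
rewrite (_ : (1 - c) * x + c * y = z) //.
have E : c * (y - x) = z - x by rewrite divfK // gt_eqF // subr_gt0.
lra.
Qed.

Lemma portion_constant_sign e : constant_sign_portion D (portion e).
Proof.
split; [by move=> t [] | exact: portion_interval|].
by move=> s t [_ ->] [_ ->].
Qed.

Lemma maximal_portionP e I t : maximal_portion D I -> I t ->
  sign_vector (lasso D t) = signs R e -> I = portion e.
Proof.
move=> [[I0 _ Is] Imax] It se; apply/esym/Imax; first exact: portion_constant_sign.
by move=> s Js; split; [exact: I0|rewrite (Is _ _ Js It)].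
Qed.

Lemma portion_maximal e t : portion e t -> maximal_portion D (portion e).
Proof.
move=> et; split=> [|J [J0 _ Js] eJ]; first exact: portion_constant_sign.
apply/seteqP; split=> // s sJ; split; first exact: J0.
by rewrite (Js s t) //; [case: et|exact: eJ].
Qed.

Lemma orthant_interior e : (orthant e)° = [set x : 'cV[R]_p | sign_vector x = signs R e].
Proof.
apply/seteqP; split=> x.
  rewrite /interior /= => /nbhs_ballP[r /= r0 xr]; apply/sign_vectorP => j.
  (* Moving every coordinate by [r / 2] towards the walls stays in the orthant, so each coordinate
     is at least [r / 2] away from zero. *)
  have /xr/(_ j) : ball x r (x - (r / 2) *: signs R e).
    split=> // i k; rewrite ord1 /ball /= !mxE opprD opprK addrA subrr add0r.
    rewrite normrM normrX normrN1 expr1n mulr1 ger0_norm; last by rewrite divr_ge0 ?ltW.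
    by rewrite ltr_pdivrMr // ltr_pMr // ltr1n.
  rewrite !mxE mulrBr (mulrCA _ (r / 2)) -expr2 sqrr_sign mulr1 subr_ge0.
  by apply: lt_le_trans; rewrite divr_gt0.
move=> /= /sign_vectorP sx.
have [r r0 hr] := finite_lower_bound sx.
rewrite /interior /=; apply/nbhs_ballP; exists r => //= y xy j.
have := xy.2 j 0; rewrite /ball /= => /ltW; rewrite -(normrMsign (e j)).
move/(le_trans (ler_norm _)); rewrite mulrBr => h.
by have := hr j; lra.
Qed.

Lemma full_dim_segmentP S : full_dim_segments D S ->
  exists e, portion e !=set0 /\ S = lasso D @` portion e.
Proof.
move=> [[I [Imax -> _]] [e [x [[t It <-]]]]]; rewrite orthant_interior /= => se.
exists e; rewrite -(maximal_portionP Imax It se); split=> //; by exists t.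
Qed.

(** A positive multiplier leaves room to move along [K^-1 s], which lowers [lam] and keeps
    stationarity. The second point so obtained shows that the segment has positive length. *)
Lemma segment_of_stationary e lam beta : 0 < lam -> stationary D e lam beta ->
  full_dim_segments D (lasso D @` portion e).
Proof.
move=> lam0 st; have [_ se Kb] := st; have /sign_vectorP sp := se.
have [v Kv] : exists v, K *m v = signs R e.
  by exists (invmx K *m signs R e); rewrite mulmxA mulmxV ?mul1mx // cov_unit.
(* [None] keeps the multiplier nonnegative and [Some j] keeps the sign of coordinate [j]; the [1 +]
   makes the latter strict. *)
pose F (o : option 'I_p) := 
  if o is Some j then ((-1) ^+ e j * beta j 0) / (1 + `|v j 0|) else lam.
have F0 o : 0 < F o.
  by case: o => //= j; rewrite divr_gt0 // ltr_pwDl.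
have [r r0 hr] := finite_lower_bound F0.
have st' : stationary D e (lam - r) (beta + r *: v).
  split; first by rewrite subr_ge0 (hr None).
    apply/sign_vectorP => j; have := hr (Some j); rewrite /= ler_pdivlMr ?ltr_pwDl //.
    rewrite !mxE mulrDr mulrDr mulr1 => h.
    have : - (r * `|v j 0|) <= (-1) ^+ e j * (r * v j 0).
      rewrite mulrCA -mulrN ler_pM2l // lerNl -mulrN.
      by apply: le_trans (ler_norm _) _; rewrite normrMsign normrN.
    by move: h r0; rewrite /=; lra.
  by rewrite mulmxDr -scalemxAr Kv Kb scalerBl opprB -addrA (addrC (- _)).
have inS gam mu : stationary D e mu gam -> (lasso D @` portion e) gam.
  by move=> sg; exists (l1norm gam); [exact: portion_of_stationary sg|exact: stationary_lasso sg].
split.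
  exists (portion e); split=> //; first exact: portion_maximal (portion_of_stationary st).
  exists beta, (beta + r *: v); split; [exact: inS st|exact: inS st'|].
  rewrite -subr_eq0 opprD addrA subrr add0r oppr_eq0 scaler_eq0 gt_eqF //=.
  apply/eqP => v0; move: Kv; rewrite v0 mulmx0 => /matrixP/(_ (Ordinal p0) 0).
  by rewrite !mxE => /esym/eqP; rewrite signr_eq0.
by exists e, beta; split; [exact: inS st|rewrite orthant_interior].
Qed.

Lemma segment_inj e e' : portion e !=set0 ->
  lasso D @` portion e = lasso D @` portion e' -> e =1 e'.
Proof.
move=> [t et] h; have : (lasso D @` portion e') (lasso D t) by rewrite -h; exists t.
move=> [s [_ se'] E]; case: et => _ se; rewrite E in se'.
exact: sign_vector_inj se se'.
Qed.

End Portions.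

(** * Designs whose paths meet every orthant up to sign *)

Section Construction.
Variable R : realType.

(** Linear independence of the columns of [X] together with [y], the matrix form of the full rank
    condition. *)
Definition trivial_kernel n p (X : 'M[R]_(n, p)) (y : 'cV[R]_n) :=
  forall x c, X *m x + c *: y = 0 -> x = 0 /\ c = 0.

(* [q = (eps, lam, beta)]: up to the sign [eps] of the response, [beta] is a
   lasso solution with signs [e] for the design [X] and the response [y]. *)
Definition solution n p (X : 'M[R]_(n, p)) (y : 'cV[R]_n) (e : 'I_p -> bool)
    (q : bool * R * 'cV[R]_p) :=
  [/\ 0 < q.1.2, sign_vector q.2 = signs R e &
      X^T *m (X *m q.2 - (-1) ^+ q.1.1 *: y) = - q.1.2 *: signs R e].

Lemma signsN p (e : 'I_p -> bool) : signs R (fun j => ~~ e j) = - signs R e.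
Proof.
by apply/matrixP => i k; rewrite !mxE; case: (e i); rewrite ?expr1 ?expr0 ?opprK.
Qed.

Lemma sign_vectorN p (x : 'cV[R]_p) : sign_vector (- x) = - sign_vector x.
Proof. by apply/matrixP => i j; rewrite !mxE sgrN. Qed.

Lemma solutionN n p (X : 'M[R]_(n, p)) y (e : 'I_p -> bool) q :
  solution X y e q -> solution X y (fun j => ~~ e j) (~~ q.1.1, q.1.2, - q.2).
Proof.
move=> [l0 se Xe]; split=> //=; first by rewrite sign_vectorN signsN se.
rewrite signsN scalerN -Xe -mulmxN opprB mulmxN; congr (_ *m _).
by rewrite signrN scaleNr opprK addrC.
Qed.

Definition extended_design n p (X : 'M[R]_(n, p)) (y : 'cV[R]_n) (a : R) :
  'M[R]_(n + 1, p + 1) := block_mx X ((2 * a) *: y) 0 (a%:M).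

Definition extended_response n (y : 'cV[R]_n) : 'cV[R]_(n + 1) := col_mx y 1%:M.

Lemma extended_trivial_kernel n p (X : 'M[R]_(n, p)) y a : a != 0 ->
  trivial_kernel X y ->
  trivial_kernel (extended_design X y a) (extended_response y).
Proof.
move=> a0 tk x c; rewrite -[x]vsubmxK [dsubmx x]mx11_scalar.
set x1 := usubmx x; set x2 := dsubmx x 0 0.
rewrite mul_block_col scale_col_mx add_col_mx.
have -> : 0 = col_mx 0 0 :> 'cV[R]_(n + 1) by rewrite col_mx0.
move=> /eq_col_mx[]; rewrite -scalemxAl mul_mx_scalar scalerA -addrA -scalerDl => /tk[x10 h].
rewrite mul0mx add0r -scalar_mxM scale_scalar_mx mulr1 => /matrixP/(_ 0 0).
rewrite !mxE !mulr1n => h'.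
have E : a * x2 = 0 by lra.
have x20 : x2 = 0 by apply/eqP; move/eqP: E; rewrite mulf_eq0 (negPf a0).
split; last by move: h'; rewrite E add0r.
by rewrite x10 x20 raddf0 col_mx0.
Qed.

(* Mairal and Yu's recursive construction of lasso paths with exponentially
   many segments: the new coefficient [bn] grows along the path, and the old
   coefficients are those of the old path multiplied by [1 - 2 * a * bn], whose
   sign changes, so that each old orthant is met again together with its
   opposite. *)
Lemma extend_solution n p (X : 'M[R]_(n, p)) y (e : 'I_(p + 1) -> bool)
    (q : bool * R * 'cV_p) (a : R) :
  let r := X *m q.2 - (-1) ^+ q.1.1 *: y in
  let kappa := 2 * dot y r - (-1) ^+ q.1.1 / 2 in
  0 < a -> a * (1 + `|kappa|) <= q.1.2 -> e (rshift p 0) = false ->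
  solution X y (fun j => e (lshift 1 j)) q ->
  exists lam beta, solution (extended_design X y a) (extended_response y) e
    (false, lam, beta).
Proof.
case: q => [[eps lam] B] r kappa a0 al e0 [/= lam0 /sign_vectorP sB Xr].
pose s : R := (-1) ^+ eps; move: Xr al; rewrite /= -/s -/(r) => Xr al.
have den : a / 2 < lam + a * kappa.
  have : - (a * `|kappa|) <= a * kappa.
    by rewrite -mulrN ler_pM2l // lerNl -normrN ler_norm.
  lra.
(* The stationarity equation of the new column reads [rho * (lam + a * kappa) = a / 2]. The bound on
   [a] forces [rho < 1], hence [bn > 0] for either sign [s]. *)
pose rho := (a / 2) / (lam + a * kappa).
have den0 : 0 < lam + a * kappa by lra.
have rho0 : 0 < rho by rewrite divr_gt0 // divr_gt0.
have rho1 : rho < 1 by rewrite /rho ltr_pdivrMr // mul1r.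
have rhoE : rho * (lam + a * kappa) = a / 2 by rewrite divfK // gt_eqF.
have srho : rho * s < 1.
  by rewrite /s; case: (eps); rewrite ?expr1 ?expr0; lra.
(* Chosen so that the effective response [(1 - 2 * a * bn) *: y] of the old rows is [rho * s] times
   [y], which scales the old residual to [rho *: r]. *)
pose bn := (1 - rho * s) / (2 * a).
have bn0 : 0 < bn by rewrite divr_gt0 ?subr_gt0 // mulr_gt0.
have bnE : 2 * a * bn = 1 - rho * s by rewrite mulrC divfK // gt_eqF ?mulr_gt0.
have signsE : signs R e = col_mx (signs R (fun j => e (lshift 1 j))) 1%:M.
  apply/matrixP => i k; rewrite mxE -[i]fintype.splitK.
  case: (fintype.split i) => j /=; rewrite ?col_mxEu ?col_mxEd ?mxE // !ord1 e0 expr0.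
  by rewrite eqxx mulr1n.
exists (rho * lam), (col_mx (rho *: B) bn%:M); split => /=; first exact: mulr_gt0.
  apply/sign_vectorP => i; rewrite -[i]fintype.splitK.
  case: (fintype.split i) => j /=; rewrite ?col_mxEu ?col_mxEd mxE.
    by rewrite mulrCA mulr_gt0.
  by rewrite !ord1 e0 expr0 mul1r eqxx mulr1n.
rewrite expr0 scale1r mul_block_col opp_col_mx add_col_mx.
have -> : X *m (rho *: B) + (2 * a) *: y *m bn%:M - y = rho *: r.
  rewrite -scalemxAr mul_mx_scalar scalerA (mulrC bn) bnE.
  rewrite /r /= -/s scalerBr scalerA -addrA; congr (_ + _).
  by rewrite scalerBl scale1r addrAC subrr add0r.
have -> : 0 *m (rho *: B) + a%:M *m bn%:M - 1%:M = (- (1 + rho * s) / 2)%:M :> 'M[R]_(1).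
  rewrite mul0mx add0r -scalar_mxM -raddfB; congr (_%:M).
  by have := bnE; lra.
rewrite tr_block_mx mul_block_col trmx0 mul0mx addr0 signsE scale_col_mx.
congr col_mx; first by rewrite -scalemxAr Xr scalerA mulrN.
rewrite [(_ *: y)^T]linearZ /= -scalemxAl -scalemxAr tr_scalar_mx -scalar_mxM scale_scalar_mx.
apply/matrixP => i k; rewrite !ord1 mxE [X in X + _]mxE [X in _ * X]mxE -dotE !mxE !mulr1n.
move: rhoE; rewrite /kappa -/s; lra.
Qed.

(** Induction on [p]: a positive last sign comes from [extend_solution], a negative one by negating
    a solution for the opposite pattern. *)
Lemma all_sign_solutions p : exists n (X : 'M[R]_(n, p)) y,
  trivial_kernel X y /\ forall e, exists q, solution X y e q.
Proof.
elim: p => [|p [n [X [y [tk sol]]]]].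
  exists 1, 0, 1%:M; split=> [x c|e].
    rewrite mul0mx add0r scale_scalar_mx mulr1 => /matrixP/(_ 0 0); rewrite !mxE mulr1n.
    by split=> //; apply/matrixP => -[].
  by exists (false, 1, 0); split=> //=; apply/matrixP => -[].
(* One [a] must serve all old patterns; finite functions make the index type finite, so a common
   lower bound exists. *)
have [/= q hq] := choice (fun f : {ffun 'I_p -> bool} => sol f).
pose kappa f := let r := X *m (q f).2 - (-1) ^+ (q f).1.1 *: y in
  2 * dot y r - (-1) ^+ (q f).1.1 / 2.
have pos f : 0 < 1 + `|kappa f| by rewrite ltr_pwDl.
have F0 f : 0 < (q f).1.2 / (1 + `|kappa f|).
  by have [q0 _ _] := hq f; rewrite divr_gt0.
have [a a0 ha] := finite_lower_bound F0.
rewrite -addn1.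
exists (n + 1)%N, (extended_design X y a), (extended_response y); split.
  by apply: extended_trivial_kernel => //; rewrite gt_eqF.
have ext e : e (rshift p 0) = false -> exists q,
    solution (extended_design X y a) (extended_response y) e q.
  move=> e0; pose f := [ffun j => e (lshift 1 j)].
  have st : solution X y (fun j => e (lshift 1 j)) (q f).
    rewrite (_ : (fun j => _) = f) //; apply/funext => j; by rewrite ffunE.
  have le : a * (1 + `|kappa f|) <= (q f).1.2 by rewrite -ler_pdivlMr //; exact: ha.
  have [lam [beta h]] := extend_solution a0 le e0 st.
  by exists (false, lam, beta).
move=> e; have [e1|/negbTE e0] := boolP (e (rshift p 0)); last exact: ext.
have [|q' /solutionN h] := ext (fun j => ~~ e j); first by rewrite e1.
exists (~~ q'.1.1, q'.1.2, - q'.2).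
by rewrite (_ : e = (fun j => ~~ ~~ e j)) //; apply/funext => j; rewrite negbK.
Qed.

(** * Data centered by adding the negative of each row of [(X, y)] *)

Section SymmetrizedDataset.
Variables (n p : nat) (X : 'M[R]_(n, p)) (y : 'cV[R]_n).
Hypothesis tk : trivial_kernel X y.

Let point k : 'cV[R]_(p + 1) := (row k (row_mx X y))^T.

Let sym_datum (i : 'I_(n + n)) : 'cV[R]_(p + 1) :=
  match fintype.split i with inl k => point k | inr k => - point k end.

Let sum_sym (V : zmodType) (f : 'cV[R]_(p + 1) -> V) :
  \sum_i f (sym_datum i) = \sum_k (f (point k) + f (- point k)).
Proof.
rewrite big_split_ord big_split /=.
congr (_ + _); apply: eq_bigr => k _; rewrite /sym_datum.
  by rewrite (unsplitK (inl k)).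
by rewrite (unsplitK (inr k)).
Qed.

Let sym_centered : (n + n)%:R^-1 *: \sum_i sym_datum i = 0.
Proof. by rewrite (sum_sym id) big1 ?scaler0 // => k _; rewrite subrr. Qed.

Let point_span (U : {vspace 'cV[R]_(p + 1)}) : (forall k, point k \in U) -> U = fullv.
Proof.
move=> hU; apply/vspaceP => w; rewrite memvf.
have full : row_full (row_mx X y).
  rewrite /row_full -mxrank_tr; apply: inj_row_free => v hv.
  have : row_mx X y *m v^T = 0 by rewrite -[LHS]trmxK trmx_mul trmxK hv trmx0.
  rewrite -[v^T]vsubmxK [dsubmx _]mx11_scalar mul_row_col mul_mx_scalar => /tk[h1 h2].
  apply: trmx_inj; rewrite -[v^T]vsubmxK [dsubmx _]mx11_scalar h1 h2.
  by rewrite raddf0 col_mx0 trmx0.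
pose u := w^T *m pinvmx (row_mx X y).
have -> : w = \sum_k u 0 k *: point k.
  apply: trmx_inj; rewrite linear_sum /= -[LHS]mulmx1 -(mulVpmx full) mulmxA.
  by rewrite mulmx_sum_row; apply: eq_bigr => k _; rewrite linearZ /= trmxK.
by apply: memv_suml => k _; rewrite memvZ.
Qed.

(** Subtracting the memberships of a point and its negative cancels [v] and leaves twice the point
    in [U]. *)
Let sym_full_rank v (U : {vspace 'cV[R]_(p + 1)}) :
  (forall i, sym_datum i - v \in U) -> U = fullv.
Proof.
move=> hU; apply: point_span => k.
have := memvB (hU (unsplit (inl k))) (hU (unsplit (inr k))).
rewrite /sym_datum !unsplitK opprB addrA subrK opprK -mulr2n -scaler_nat.
by move/(memvZ 2^-1); rewrite scalerA mulVf ?scale1r // pnatr_eq0.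
Qed.

Definition symmetrized_dataset := Dataset sym_centered sym_full_rank.

Lemma design_rows_gt0 : (0 < n)%N.
Proof.
case: posnP => // n0; have [|_ /eqP] := @tk 0 1; last by rewrite oner_eq0.
by apply/matrixP => i; have := leq_trans (ltn_ord i) (eq_leq n0).
Qed.

Let two_invn : (n + n)%:R^-1 * 2 = n%:R^-1 :> R.
Proof.
have n0 : n%:R != 0 :> R by rewrite pnatr_eq0 -lt0n design_rows_gt0.
by rewrite natrD; field; rewrite n0 /= -mulr2n mulrn_eq0.
Qed.

Let usubmx_point k i : usubmx (point k) i 0 = X k i.
Proof. by rewrite 3!mxE row_mxEl. Qed.

Let dsubmx_point k : dsubmx (point k) 0 0 = y k 0.
Proof. by rewrite 3!mxE row_mxEr. Qed.

Let usubmxN_point k i : usubmx (- point k) i 0 = - X k i.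
Proof. by rewrite 4!mxE row_mxEl. Qed.

Let dsubmxN_point k : dsubmx (- point k) 0 0 = - y k 0.
Proof. by rewrite 4!mxE row_mxEr. Qed.

Lemma symmetrized_covariance :
  predictor_covariance symmetrized_dataset = n%:R^-1 *: (X^T *m X).
Proof.
rewrite /predictor_covariance /predictors /=.
rewrite (sum_sym (fun d => usubmx d *m (usubmx d)^T)) -two_invn -scalerA.
congr (_ *: _); apply/matrixP => i j; rewrite summxE 2!mxE mulr_sumr.
apply: eq_bigr => k _; rewrite mxE [X in X + _]mxE [X in _ + X]mxE !big_ord1.
by rewrite ![_^T _ _]mxE !usubmx_point !usubmxN_point; ring.
Qed.

Lemma symmetrized_cross_covariance :
  cross_covariance symmetrized_dataset = n%:R^-1 *: (X^T *m y).
Proof.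
rewrite /cross_covariance /predictors /response /=.
rewrite (sum_sym (fun d => dsubmx d 0 0 *: usubmx d)) -two_invn -scalerA.
congr (_ *: _); apply/matrixP => i j; rewrite ord1 summxE 2!mxE mulr_sumr.
apply: eq_bigr => k _; rewrite mxE [X in X + _]mxE [X in _ + X]mxE.
rewrite usubmx_point dsubmx_point usubmxN_point dsubmxN_point [_^T _ _]mxE.
ring.
Qed.

Lemma symmetrized_stationary e q : solution X y e q ->
  exists lam beta, 0 < lam /\
    stationary symmetrized_dataset (fun j => q.1.1 (+) e j) lam beta.
Proof.
case: q => [[eps lam] beta] /= h; exists (n%:R^-1 * lam).
have n0 : 0 < n%:R^-1 :> R by rewrite invr_gt0 ltr0n design_rows_gt0.
(* A solution for the response [- y] becomes, after negation, one for [y] with flipped signs, whence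
   the pattern [eps (+) e]. *)
wlog eps0 : eps lam beta e h / eps = false.
  move=> H; case: eps h => h; last exact: H h erefl.
  have [beta' [l0 st]] := H _ _ _ _ (solutionN h) erefl.
  by exists beta'; split.
rewrite {}eps0 in h *; exists beta; case: h => /= l0 se Xe; split; first exact: mulr_gt0.
split=> //; first by rewrite mulr_ge0 ?(ltW l0) ?(ltW n0).
rewrite symmetrized_covariance symmetrized_cross_covariance -scalemxAl -mulmxA.
rewrite -scalerA -scalerBr; congr (_ *: _); move: Xe.
rewrite [(-1) ^+ _]expr0 scale1r mulmxBr => /(canRL (subrK _)) ->.
by rewrite scaleNr addrC.
Qed.

End SymmetrizedDataset.

(** * Rescaling the data to leave the normalized case *)

Lemma trivial_kernelZ n p (X : 'M[R]_(n, p)) y c : c != 0 ->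
  trivial_kernel X y -> trivial_kernel (c *: X) (c *: y).
Proof.
move=> c0 tk x d; rewrite -scalemxAl scalerA (mulrC d) -scalerA -scalerDr.
by move/eqP; rewrite scaler_eq0 (negPf c0) => /eqP/tk.
Qed.

Lemma solutionZ n p (X : 'M[R]_(n, p)) y (e : 'I_p -> bool) q c : c != 0 ->
  solution X y e q -> solution (c *: X) (c *: y) e (q.1.1, c ^+ 2 * q.1.2, q.2).
Proof.
move=> c0 [l0 se Xe]; split=> //=.
  by rewrite mulr_gt0 // lt_def sqr_ge0 sqrf_eq0 c0.
rewrite -scalemxAl scalerA (mulrC _ c) -scalerA -scalerBr [(c *: X)^T]linearZ /=.
by rewrite -scalemxAl -scalemxAr scalerA -expr2 Xe scalerA mulrN.
Qed.

(** If the symmetrized data happen to be normalized, doubling them turns the unit diagonal into 4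
    while the same sign patterns remain stationary. *)
Lemma dataset_visiting_all_signs p : (0 < p)%N ->
  exists D : dataset R p, ~ normalized D /\ forall e, exists eps lam beta,
    0 < lam /\ stationary D (fun j => eps (+) e j) lam beta.
Proof.
move=> p0; have [n [X [y [tk sol]]]] := all_sign_solutions p.
have two0 : 2 != 0 :> R by rewrite pnatr_eq0.
have visits m (Y : 'M[R]_(m, p)) z (tk' : trivial_kernel Y z) e :
    (exists q, solution Y z e q) -> exists eps lam beta, 0 < lam /\
    stationary (symmetrized_dataset tk') (fun j => eps (+) e j) lam beta.
  by move=> [q /(symmetrized_stationary tk') h]; exists q.1.1.
have [n1|nn] := pselect (normalized (symmetrized_dataset tk)); last first.
  by exists (symmetrized_dataset tk); split=> // e; exact/visits/sol.
exists (symmetrized_dataset (trivial_kernelZ two0 tk)); split=> [n2|e]; last first.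
  by apply: visits; have [q /(solutionZ two0) h] := sol e; eexists; exact: h.
have := n2 (Ordinal p0); have := n1 (Ordinal p0).
rewrite !symmetrized_covariance [(2 *: X)^T]linearZ /= -scalemxAl -scalemxAr.
move: (X^T *m X) => G; rewrite 4!mxE mulrCA (mulrCA n%:R^-1) => -> h.
lra.
Qed.

End Construction.

(** * Counting segments by binary words *)

Lemma card_set_mem (T : finType) (A : {set T}) :
  [set x | x \in A] #= `I_#|A|.
Proof.
rewrite card_eq_sym; pose f x := index x (enum A).
have -> : `I_#|A| = f @` [set x | x \in A].
  apply/seteqP; split=> [k /= kA|_ [x /= xA <-]]; last first.
    by rewrite cardE index_mem mem_enum.
  exists (enum_val (Ordinal kA)); first exact: enum_valP.
  by rewrite /f (enum_val_nth (enum_val (Ordinal kA))) index_uniq ?enum_uniq // -cardE.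
apply: inj_card_eq => x y /set_mem /= xA /set_mem /= yA.
by apply: (index_inj x); rewrite mem_enum.
Qed.

Section Counting.
Variables (R : realType) (p : nat).
Hypothesis p0 : (0 < p)%N.
Implicit Types D : dataset R p.

(** The patterns met by the path form a family admissible for [max_matching_words p r], and every
    full-dimensional segment is the image of one of them. *)
Lemma full_dim_segments_le D r :
  (forall (u v : p.-tuple bool) lam mu beta gam, u != v ->
    stationary D (tnth u) lam beta -> stationary D (tnth v) mu gam ->
    (r <= matches u v)%N) ->
  full_dim_segments D #<= `I_(max_matching_words p r).
Proof.
move=> hr; pose A := [set u : p.-tuple bool | `[< portion D (tnth u) !=set0 >] ]%SET.
pose f (u : p.-tuple bool) := lasso D @` portion D (tnth u).
have sub : full_dim_segments D `<=` f @` [set u | u \in A].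
  move=> S /(full_dim_segmentP p0)[e [e0 ->]].
  have E : tnth (mktuple e) = e by apply/funext => j; rewrite tnth_mktuple.
  by exists (mktuple e); rewrite /f /= ?inE E //; apply/asboolP.
apply: card_le_trans (subset_card_le sub) _.
apply: card_le_trans (card_image_le _ _) _.
rewrite (card_le_eql (card_set_mem A)) card_le_II.
apply: (leq_bigmax_cond A); apply/forall_inP => u; rewrite inE => /asboolP[s us].
apply/forall_inP => v; rewrite inE => /asboolP[t vt]; apply/implyP => uv.
have [lam su _] := portion_stationary p0 us.
have [mu sv _] := portion_stationary p0 vt.
exact: hr uv su sv.
Qed.

(** Each word [u] of an optimal family is sent to the segment with signs [u] or its complement, as
    [eps u] dictates. If [u] and [v] share a segment, a spot where they match forces
    [eps u = eps v], hence [u = v]. *)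
Lemma full_dim_segments_ge D :
  (forall e, exists eps lam beta,
    0 < lam /\ stationary D (fun j => eps (+) e j) lam beta) ->
  `I_(max_matching_words p 1) #<= full_dim_segments D.
Proof.
move=> visits.
have [A Aok ->] : exists2 A : {set p.-tuple bool},
    [forall u in A, forall v in A, (u != v) ==> (1 <= matches u v)%N] &
    max_matching_words p 1 = #|A|.
  have [|A Aok E] := @eq_bigmax_cond _ [pred A : {set p.-tuple bool} |
    [forall u in A, forall v in A, (u != v) ==> (1 <= matches u v)%N]]
      (fun A => #|A|).
    by apply/card_gt0P; exists finset.set0; apply/forall_inP => u; rewrite finset.in_set0.
  by exists A.
have [eps heps] := choice (fun u : p.-tuple bool => visits (tnth u)).
pose f (u : p.-tuple bool) := lasso D @` portion D (fun j => eps u (+) tnth u j).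
rewrite -(card_le_eql (card_set_mem A)).
have finj : {in [set u | u \in A] &, injective f}.
  move=> u v /set_mem /= uA /set_mem /= vA fuv.
  have [lam [beta [_ su]]] := heps u.
  have h : (fun j => eps u (+) tnth u j) =1 (fun j => eps v (+) tnth v j).
    by apply: segment_inj fuv; exists (l1norm beta); exact: portion_of_stationary su.
  apply/eqP; apply: contraT => uv.
  have /forall_inP/(_ _ uA)/forall_inP/(_ _ vA)/implyP/(_ uv) := Aok.
  move=> /card_gt0P[j]; rewrite inE => /eqP uvj.
  have /= := h j; rewrite uvj => /addIb epsE.
  rewrite -(negbTE uv); apply/eqP/eq_from_tnth => k.
  by have /= := h k; rewrite epsE => /addbI.
rewrite -(card_le_eql (inj_card_eq finj)); apply: subset_card_le => _ [u _ <-].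
have [lam [beta [l0 su]]] := heps u.
exact: segment_of_stationary p0 _ _ _ l0 su.
Qed.

Lemma stationary_matches_gt0 D (u v : p.-tuple bool) lam mu beta gam :
  stationary D (tnth u) lam beta -> stationary D (tnth v) mu gam ->
  (1 <= matches u v)%N.
Proof.
move=> su sv; have [j uvj] := stationary_opposite p0 su sv.
by apply/card_gt0P; exists j; rewrite inE uvj.
Qed.

End Counting.

Theorem proposition6p1 (R : realType) (p : nat) (hp : (2 <= p)%N) :
  ((forall D : dataset R p, ~ normalized D ->
      full_dim_segments D #<= `I_(max_matching_words p 1)) /\
   (exists D : dataset R p, ~ normalized D /\
      full_dim_segments D #= `I_(max_matching_words p 1))) /\
  (forall D : dataset R p, normalized D ->
      full_dim_segments D #<= `I_(max_matching_words p 2)).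
Proof.
have p0 : (0 < p)%N by exact: ltnW.
have upper (D : dataset R p) : full_dim_segments D #<= `I_(max_matching_words p 1).
  by apply: full_dim_segments_le => // u v lam mu beta gam _; exact: stationary_matches_gt0.
split; first split=> [D _|]; first exact: upper.
  have [D [nn visits]] := dataset_visiting_all_signs R p0.
  exists D; split=> //; apply: Cantor_Bernstein; first exact: upper.
  exact: full_dim_segments_ge.
move=> D nD; apply: full_dim_segments_le => // u v lam mu beta gam _ su sv.
have [j0 uvj0] := stationary_opposite p0 su sv.
have [j1 j10 uvj1] := stationary_two_matches nD hp su sv uvj0.
by apply/card_gt1P; exists j1, j0; rewrite !inE uvj0 uvj1.
Qed.
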